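(* Let $X\in\mathbb{H}^{n\times m}$, $S\in\mathbb{H}^{n\times k}$ and $T\in\mathbb{H}^{l\times m}$. Then: (a) $\mathcal{R}_r(X)\subseteq\mathcal{R}_r(S)$ if and only if there exists $U\in\mathbb{H}^{k\times m}$ such that $X=SU$. (b) $\mathcal{N}_r(T)\subseteq\mathcal{N}_r(X)$ if and only if there exists $V\in\mathbb{H}^{n\times l}$ such that $X=VT$.
   Context: $\mathbb{H}$ denotes the real quaternions. For $B\in\mathbb{H}^{p\times q}$, $\mathcal{R}_r(B)=\{Bx : x\in\mathbb{H}^{q\times 1}\}$ and $\mathcal{N}_r(B)=\{x\in\mathbb{H}^{q\times 1} : Bx=0\}$ are the right range and right null space. *)

(* Defs.v *)
From HB Require Import structures.
From mathcomp Require Import all_boot all_order all_algebra.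
From mathcomp Require Import ring.
From mathcomp Require Import classical_sets reals.

Set Implicit Arguments.
Unset Strict Implicit.
Unset Printing Implicit Defensive.

Import GRing.Theory.
Local Open Scope ring_scope.

(* [Quat a b c d] is the real quaternion a + b i + c j + d k. *)
Record quaternion (R : realType) :=
  Quat { qre : R; qi : R; qj : R; qk : R }.

Section Quaternion.
Variable R : realType.
Local Notation H := (quaternion R).
Implicit Types x y z : H.

Definition quat_to_prod x : R * R * R * R := (qre x, qi x, qj x, qk x).
Definition quat_of_prod (p : R * R * R * R) : H :=
  let: (a, b, c, d) := p in Quat a b c d.

Lemma quat_to_prodK : cancel quat_to_prod quat_of_prod.
Proof. by case. Qed.

HB.instance Definition _ := Choice.copy H (can_type quat_to_prodK).

Definition quat_zero : H := Quat 0 0 0 0.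
Definition quat_one : H := Quat 1 0 0 0.

Definition quat_opp x : H := Quat (- qre x) (- qi x) (- qj x) (- qk x).

Definition quat_add x y : H :=
  Quat (qre x + qre y) (qi x + qi y) (qj x + qj y) (qk x + qk y).

(* Hamilton's product: i^2 = j^2 = k^2 = -1, ij = k = -ji, jk = i = -kj,
   ki = j = -ik. *)
Definition quat_mul x y : H :=
  Quat (qre x * qre y - qi x * qi y - qj x * qj y - qk x * qk y)
       (qre x * qi y + qi x * qre y + qj x * qk y - qk x * qj y)
       (qre x * qj y - qi x * qk y + qj x * qre y + qk x * qi y)
       (qre x * qk y + qi x * qj y - qj x * qi y + qk x * qre y).

Lemma quat_addA : associative quat_add.
Proof. by move=> [? ? ? ?] [? ? ? ?] [? ? ? ?]; congr Quat; rewrite /= addrA. Qed.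

Lemma quat_addC : commutative quat_add.
Proof. by move=> [? ? ? ?] [? ? ? ?]; congr Quat; rewrite /= addrC. Qed.

Lemma quat_add0 : left_id quat_zero quat_add.
Proof. by move=> [? ? ? ?]; congr Quat; rewrite /= add0r. Qed.

Lemma quat_addN : left_inverse quat_zero quat_opp quat_add.
Proof. by move=> [? ? ? ?]; congr Quat; rewrite /= addNr. Qed.

HB.instance Definition _ :=
  GRing.isZmodule.Build H quat_addA quat_addC quat_add0 quat_addN.

Lemma quat_mulA : associative quat_mul.
Proof. by move=> [? ? ? ?] [? ? ? ?] [? ? ? ?]; congr Quat; rewrite /=; ring. Qed.

Lemma quat_mul1 : left_id quat_one quat_mul.
Proof. by move=> [? ? ? ?]; congr Quat; rewrite /=; ring. Qed.

Lemma quat_1mul : right_id quat_one quat_mul.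
Proof. by move=> [? ? ? ?]; congr Quat; rewrite /=; ring. Qed.

Lemma quat_mulDl : left_distributive quat_mul quat_add.
Proof. by move=> [? ? ? ?] [? ? ? ?] [? ? ? ?]; congr Quat; rewrite /=; ring. Qed.

Lemma quat_mulDr : right_distributive quat_mul quat_add.
Proof. by move=> [? ? ? ?] [? ? ? ?] [? ? ? ?]; congr Quat; rewrite /=; ring. Qed.

Lemma quat_one_neq0 : quat_one != quat_zero.
Proof. by apply/eqP => -[] /eqP; rewrite oner_eq0. Qed.

HB.instance Definition _ := GRing.Zmodule_isNzRing.Build H
  quat_mulA quat_mul1 quat_1mul quat_mulDl quat_mulDr quat_one_neq0.

End Quaternion.

Section RightSpaces.
Local Open Scope classical_set_scope.
Variables (R : realType) (p q : nat).

Definition right_range (B : 'M[quaternion R]_(p, q)) :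
    set 'cV[quaternion R]_p :=
  [set B *m x | x in [set: 'cV[quaternion R]_q]].

Definition right_null (B : 'M[quaternion R]_(p, q)) :
    set 'cV[quaternion R]_q :=
  [set x | B *m x = 0].

End RightSpaces.

(* Main.v *)
Require Import Defs.
From mathcomp Require Import all_boot all_order all_algebra.
From mathcomp Require Import ring.
From mathcomp Require Import classical_sets reals.

(** For (a), solve [S u = X e_j] for each column of [X].  For (b), every matrix
[T] over a division ring has an inner inverse [G], i.e. [T G T = T]; the columns
of [1 - G T] then lie in the null space of [T], hence in that of [X], so that
[X = (X G) T]. *)

Import GRing.Theory Num.Theory.
Local Open Scope classical_set_scope.
Local Open Scope ring_scope.

Section MatrixInnerInverse.
Variable D : pzRingType.
Hypothesis rinv_neq0 : forall x : D, x != 0 -> exists y, x * y = 1.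

(** The product is column [j] of [A] times row [k] of [B] with [b] in between; as [D] need not
    commute, the order in [A i j * b] matters. *)
Lemma row_mulmx_delta (m n p : nat) (A : 'M[D]_(m, n)) (B : 'M[D]_(p, n))
    (i : 'I_m) (j : 'I_n) (k : 'I_p) (b : D) :
  row i (A *m (b *: delta_mx j k) *m B) = (A i j * b) *: row k B.
Proof.
rewrite !row_mul; apply/rowP => c; rewrite !mxE (bigD1 k) //= big1 ?addr0.
  rewrite !mxE (bigD1 j) //= big1 ?addr0 => [|j' /negPf nj].
    by rewrite !mxE !eqxx mulr1.
  by rewrite !mxE nj !mulr0.
move=> k' /negPf nk; rewrite !mxE big1 ?mul0r // => j' _.
by rewrite !mxE nk andbF !mulr0.
Qed.

(** Elimination on the residual [T - T *m G *m T]: each index of [r] costs at most one single-pivot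
    correction of [G], which clears that row and keeps the cleared ones zero. *)
Lemma inner_inverse_rows (l m : nat) (T : 'M[D]_(l, m)) (r : seq 'I_l) :
  exists G : 'M[D]_(m, l), {in r, forall i, row i (T - T *m G *m T) = 0}.
Proof.
elim: r => [|i r [G HG]]; first by exists 0.
set A := T - T *m G *m T in HG.
have [Ai0|Ai] := eqVneq (row i A) 0.
  by exists G => k; rewrite inE => /predU1P[->|/HG].
have [j Aij] : exists j, A i j != 0.
  by case/rV0Pn: Ai => j; rewrite mxE; exists j.
have [b Aijb] := rinv_neq0 _ Aij.
(* The pivot [A i j] is met by its right inverse [b], so row [i] of [A *m H *m A] is row [i] of [A]
   itself. *)
pose H : 'M[D]_(m, l) := b *: delta_mx j i.
(* McCoy's trick: an inner inverse of [T - T G T] yields one of [T]. *)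
exists (G + (1%:M - G *m T) *m H *m (1%:M - T *m G)) => k.
have -> : T - T *m (G + (1%:M - G *m T) *m H *m (1%:M - T *m G)) *m T
    = A - A *m H *m A.
  (* The factors around [H] combine with the outer [T] on each side into [A]. *)
  have AL : A = T *m (1%:M - G *m T) by rewrite mulmxBr mulmx1 mulmxA.
  have AR : A = (1%:M - T *m G) *m T by rewrite mulmxBl mul1mx.
  rewrite (mulmxDr T) (mulmxDl _ _ T) opprD addrA -/A; congr (_ - _).
  by rewrite {1}AL AR !mulmxA.
rewrite inE raddfB /= row_mulmx_delta => /predU1P[->|kr].
  by rewrite Aijb scale1r subrr.
(* A row cleared earlier has a zero in the pivot column, so no multiple of row [i] is subtracted
   from it. *)
have Ak0 := HG k kr.
have -> : A k j = 0 by have /rowP/(_ j) := Ak0; rewrite !mxE.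
by rewrite Ak0 mul0r scale0r subrr.
Qed.

Lemma inner_inverse (l m : nat) (T : 'M[D]_(l, m)) :
  exists G : 'M[D]_(m, l), T *m G *m T = T.
Proof.
have [G HG] := inner_inverse_rows _ _ T (enum 'I_l).
exists G; apply/esym/eqP; rewrite -subr_eq0; apply/eqP/row_matrixP => i.
by rewrite HG ?mem_enum // row0.
Qed.

End MatrixInnerInverse.

(** The inverse is the conjugate divided by the squared norm [s], a sum of real squares that
    vanishes only at zero. *)
Lemma quaternion_right_inverse (R : realType) (x : quaternion R) :
  x != 0 -> exists y, x * y = 1.
Proof.
case: x => a b c d nz.
set s := a ^+ 2 + b ^+ 2 + c ^+ 2 + d ^+ 2.
have s0 : s != 0.
  apply: contra nz; rewrite !paddr_eq0 ?addr_ge0 ?sqr_ge0 // !sqrf_eq0.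
  by case/andP=> /andP[/andP[/eqP-> /eqP->] /eqP->] /eqP->.
exists (Quat (a / s) (- b / s) (- c / s) (- d / s)).
by congr Quat; rewrite /= /s; field; exact: s0.
Qed.

Theorem lemma3p16 (R : realType) (n m k l : nat)
    (X : 'M[quaternion R]_(n, m)) (S : 'M[quaternion R]_(n, k))
    (T : 'M[quaternion R]_(l, m)) :
  (right_range X `<=` right_range S <->
     exists U : 'M[quaternion R]_(k, m), X = S *m U) /\
  (right_null T `<=` right_null X <->
     exists V : 'M[quaternion R]_(n, l), X = V *m T).
Proof.
split; split.
- move=> XS.
  (* Each column of [X] is the image of a unit vector, hence in the range of [X]; finite choice
     collects the solutions that become the columns of [U]. *)
  have /fin_all_exists[u Su] (j : 'I_m) : exists u, S *m u = col j X.
    have [|u _ Su] := XS (col j X); last by exists u.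
    by exists (delta_mx j 0); rewrite -?colE.
  exists (\matrix_(i, j) u j i 0); apply/matrixP => i j.
  have /colP/(_ i) := Su j; rewrite !mxE => <-.
  by apply: eq_bigr => h _; rewrite !mxE.
- by move=> [U ->] _ [x _ <-]; exists (U *m x); rewrite ?mulmxA.
- move=> TX; have [G TGT] := inner_inverse _ (@quaternion_right_inverse R) _ _ T.
  exists (X *m G); apply/eqP; rewrite -subr_eq0; apply/eqP.
  have -> : X - X *m G *m T = X *m (1%:M - G *m T).
    by rewrite mulmxBr mulmx1 mulmxA.
  apply/matrixP => i j; have : right_null X (col j (1%:M - G *m T)).
    apply: TX; rewrite /right_null /= colE mulmxA mulmxBr mulmx1 mulmxA TGT.
    by rewrite subrr mul0mx.
  by rewrite /right_null /= colE mulmxA -colE => /colP/(_ i); rewrite !mxE.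
- by move=> [V ->] x /= Tx; rewrite /right_null /= -mulmxA Tx mulmx0.
Qed.
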